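(* Let $X$ be a real Banach space such that $X$ and $X^*$ are uniformly convex. Let $A:X\rightrightarrows X^*$ be a maximal monotone operator. Then, for every $x\in D(A)$, $$\operatorname{bd}(Ax)=\operatorname{Limsup}_{y\to x,\,y\neq x}A(y),$$ where $\operatorname{Limsup}_{y\to x,\,y\ne x}A(y)$ is the set of all $x^*\in X^*$ for which there exist sequences $y_n\to x$ in $X$ and $y_n^*\to x^*$ in $X^*$ (both in norm) with $y_n\neq x$ and $y_n^*\in A(y_n)$ for all $n\in\mathbb{N}$.
   Context: $X^*$ is the continuous dual of $X$, $\langle\cdot,\cdot\rangle$ the duality pairing, and $\operatorname{bd}$ denotes the boundary in the norm topology of $X^*$. For a set-valued operator $A:X\rightrightarrows X^*$, $D(A)=\{x\in X: Ax\neq\emptyset\}$. $A$ is monotone if $\langle x^*-y^*,x-y\rangle\ge 0$ whenever $x^*\in Ax$, $y^*\in Ay$, and maximal monotone if in addition its graph is not properly contained in the graph of another monotone operator. *)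

(* Defs.v *)
From HB Require Import structures.
From mathcomp Require Import all_boot all_order all_algebra.
From mathcomp Require Import all_classical all_reals all_analysis.

Set Implicit Arguments.
Unset Strict Implicit.
Unset Printing Implicit Defensive.

Import Order.TTheory GRing.Theory Num.Theory.
Import numFieldNormedType.Exports.

Local Open Scope classical_set_scope.
Local Open Scope ring_scope.

Definition continuous_linear (R : realType) (X : normedModType R) :
    {pred X -> R} :=
  fun f => `[< linear f /\ continuous f >].

Record dual (R : realType) (X : normedModType R) := Dual {
  dual_fun :> X -> R ;
  dual_funP : dual_fun \in @continuous_linear R X }.

Section dual_lmodule.
Context (R : realType) (X : normedModType R).

Lemma continuous_linearP (f : X -> R) :
  reflect (linear f /\ continuous f) (f \in @continuous_linear R X).
Proof. exact: asboolP. Qed.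

Lemma continuous_linear_submod_closed : submod_closed (@continuous_linear R X).
Proof.
split=> [|a f g /continuous_linearP[lf cf] /continuous_linearP[lg cg]].
  apply/continuous_linearP; split; last exact: cst_continuous.
  by move=> k x y; rewrite -[RHS]/(k *: (0 : R) + 0) scaler0 addr0.
apply/continuous_linearP; split=> [k x y|x].
  rewrite -[LHS]/(a *: f _ + g _).
  rewrite -[RHS]/(k *: (a *: f x + g x) + (a *: f y + g y)).
  by rewrite lf lg !scalerDr addrACA !scalerA mulrC.
by apply: cvgD; [apply: cvgZr; exact: cf|exact: cg].
Qed.

HB.instance Definition _ := GRing.isSubmodClosed.Build _ _
  (@continuous_linear R X) continuous_linear_submod_closed.

HB.instance Definition _ := [isSub for @dual_fun R X].
HB.instance Definition _ := [Choice of dual X by <:].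
HB.instance Definition _ := [SubChoice_isSubLmodule of dual X by <:].

Lemma dual_linear (f : dual X) : linear f.
Proof. by have /continuous_linearP[] := dual_funP f. Qed.

Lemma dual_continuous (f : dual X) : continuous f.
Proof. by have /continuous_linearP[] := dual_funP f. Qed.

HB.instance Definition _ (f : dual X) :=
  GRing.isLinear.Build R X R _ (dual_fun f) (dual_linear f).

Lemma dualDE (f g : dual X) x : (f + g) x = f x + g x.
Proof. by []. Qed.

Lemma dualZE (a : R) (f : dual X) x : (a *: f) x = a * f x.
Proof. by []. Qed.

Lemma dualNE (f : dual X) x : (- f) x = - f x.
Proof. by []. Qed.

Lemma dualBE (f g : dual X) x : (f - g) x = f x - g x.
Proof. by []. Qed.

Lemma dual0E x : (0 : dual X) x = 0.
Proof. by []. Qed.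

Lemma dualP (f g : dual X) : f =1 g -> f = g.
Proof. by move=> fg; apply/val_inj/funext. Qed.

Definition dual_norm (f : dual X) : R :=
  sup [set `|f x| | x in [set x : X | `|x| <= 1]].

Lemma dual_norm_has_sup (f : dual X) :
  has_sup [set `|f x| | x in [set x : X | `|x| <= 1]].
Proof.
split; first by exists `|f 0|, 0 => //=; rewrite normr0.
have := @continuous_linear_bounded _ _ _ 0 f (@dual_continuous f 0).
move=> /bounded_funP/(_ 1)[M fM].
by exists M => _ [x /= x1 <-]; exact: fM.
Qed.

Lemma dual_norm_ub (f : dual X) x : `|x| <= 1 -> `|f x| <= dual_norm f.
Proof.
move=> x1; have [_ fM] := dual_norm_has_sup f.
by apply: ub_le_sup => //; exists x.
Qed.

Lemma dual_norm_le (f : dual X) (M : R) :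
  (forall x, `|x| <= 1 -> `|f x| <= M) -> dual_norm f <= M.
Proof.
move=> fM; apply: ge_sup; first by have [] := dual_norm_has_sup f.
by move=> _ [x x1 <-]; exact: fM.
Qed.

Lemma dual_norm_bound (f : dual X) x : `|f x| <= dual_norm f * `|x|.
Proof.
have [->|x0] := eqVneq x 0; first by rewrite linear0 !normr0 mulr0.
have nx0 : 0 < `|x| by rewrite normr_gt0.
rewrite -ler_pdivrMr//.
have := @dual_norm_ub f (`|x|^-1 *: x).
rewrite normrZ normfV normr_id mulVf ?gt_eqF// => /(_ (lexx _)).
by rewrite linearZ /= normrM normfV normr_id mulrC.
Qed.

Lemma dual_normD (f g : dual X) :
  dual_norm (f + g) <= dual_norm f + dual_norm g.
Proof.
apply: dual_norm_le => x x1; rewrite dualDE.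
by rewrite (le_trans (ler_normD _ _))// lerD// dual_norm_ub.
Qed.

Lemma dual_normZ (a : R) (f : dual X) : dual_norm (a *: f) = `|a| * dual_norm f.
Proof.
have le_normZ b (g : dual X) : dual_norm (b *: g) <= `|b| * dual_norm g.
  apply: dual_norm_le => x x1.
  by rewrite dualZE normrM ler_wpM2l// dual_norm_ub.
apply/eqP; rewrite eq_le le_normZ/=.
have [->|a0] := eqVneq a 0.
  rewrite normr0 mul0r; apply: le_trans (@dual_norm_ub _ 0 _) => //.
  by rewrite normr0.
have /= := le_normZ a^-1 (a *: f).
by rewrite scalerA mulVf// scale1r normfV ler_pdivlMl// normr_gt0.
Qed.

Lemma dual_norm0_eq0 (f : dual X) : dual_norm f = 0 -> f = 0.
Proof.
move=> f0; apply: dualP => x; apply/eqP; rewrite -normr_le0.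
by rewrite (le_trans (dual_norm_bound f x))// f0 mul0r.
Qed.

HB.instance Definition _ := Lmodule_isNormed.Build R (dual X)
  dual_normD dual_normZ dual_norm0_eq0.

End dual_lmodule.

Lemma dual_normE (R : realType) (X : normedModType R) (f : dual X) :
  `|f| = sup [set `|f x| | x in [set x : X | `|x| <= 1]].
Proof. by []. Qed.

Definition uniformly_convex (R : realType) (V : normedModType R) : Prop :=
  forall e : R, 0 < e -> exists2 d : R, 0 < d &
    forall x y : V, `|x| = 1 -> `|y| = 1 -> e <= `|x - y| ->
      `|2^-1 *: (x + y)| <= 1 - d.

Definition boundary (T : topologicalType) (S : set T) : set T :=
  closure S `\` interior S.

Section set_valued_operators.
Context (R : realType) (X : normedModType R).
Implicit Types A B : X -> set (dual X).

Definition domain A : set X := [set x | A x !=set0].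

Definition graph A : set (X * dual X) := [set p | A p.1 p.2].

Definition monotone_operator A : Prop :=
  forall (x y : X) (xs ys : dual X),
    A x xs -> A y ys -> 0 <= (xs - ys) (x - y).

Definition maximal_monotone A : Prop :=
  monotone_operator A /\ forall B, monotone_operator B -> ~ (graph A `<` graph B).

Definition Limsup A (x : X) : set (dual X) :=
  [set xs | exists (y : nat -> X) (ys : nat -> dual X),
    [/\ y n @[n --> \oo] --> x, ys n @[n --> \oo] --> xs,
        forall n, y n != x & forall n, A (y n) (ys n)]].

End set_valued_operators.

(* Main.v *)
Require Import Defs.
From HB Require Import structures.
From mathcomp Require Import all_boot all_order all_algebra.
From mathcomp Require Import all_classical all_reals all_analysis.
From mathcomp Require Import ring lra.

Set Implicit Arguments.
Unset Strict Implicit.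
Unset Printing Implicit Defensive.

Import Order.TTheory GRing.Theory Num.Theory.
Import numFieldNormedType.Exports.

Local Open Scope classical_set_scope.
Local Open Scope ring_scope.

(** Write [j] for the norming functional of a point (Hahn-Banach) and [q] for the
    point at which a functional attains its norm (uniform convexity of [X]).

    If [A y_n] contains [f_n], with [y_n <> x], [y_n --> x] and [f_n --> xs],
    then [A x] contains [xs] because the graph is closed. If [A x] contained a
    ball around [xs], moving [xs] inside that ball in the direction of
    [j (y_n - x)] and using monotonicity would bound [f_n - xs] away from 0.

    Conversely, let [xs] be a boundary point of [A x] and [zs] a functional
    close to [xs] outside [A x]. Rockafellar's theorem for the operator
    translated by [(x, zs)] gives [A (x + y) (zs + f)] with [- f] in the duality
    map at [y]; then [y <> 0], and monotonicity against [(x, xs)] makes [y] and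
    [f] of size [O(`|xs - zs|)].

    Rockafellar's theorem follows from minimizing the Fitzpatrick function plus
    half the squared norms over [X * dual X]. Uniform convexity makes minimizing
    sequences Cauchy, and, applied in the opposite space, makes the squared norms
    differentiable. The first-order condition at a minimizer [(p, g)], together
    with maximality, yields that [(- q, - j)] belongs to the graph of [A], for
    [j] the norming functional of [p] and [q] the norming point of [g]. *)

(** * Uniform convexity in terms of squared norms *)

(** Either the two norms differ enough for strict convexity of the square to give the gap, or they
    are close and the normalized vectors stay far enough apart for uniform convexity to apply. *)
Lemma uniformly_convex_sqr (R : realType) (V : normedModType R) (M e : R) :
  uniformly_convex V -> 0 < M -> 0 < e -> exists2 d : R, 0 < d &
    forall x y : V, `|x| <= M -> `|y| <= M -> e <= `|x - y| ->
      `|2^-1 *: (x + y)| ^+ 2 <= 2^-1 * (`|x| ^+ 2 + `|y| ^+ 2) - d.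
Proof.
move=> ucV M0 e0.
have eM0 : 0 < e / (2 * M) by rewrite divr_gt0// mulr_gt0.
have [d0 d00 dP] := ucV _ eM0.
pose d1 := Num.min d0 1.
have d10 : 0 < d1 by rewrite lt_min d00 ltr01.
have d11 : d1 <= 1 by rewrite ge_min lexx orbT.
have d1d0 : d1 <= d0 by rewrite ge_min lexx.
(* These are the gaps of the two cases: a quarter of [(e / 4) ^+ 2] when the norms [s >= t] differ
   by [e / 4], and otherwise [d1 * (t * s)] with [t >= e / 4] and [s >= e / 2]. *)
exists (Num.min (e ^+ 2 / 64) (e ^+ 2 * d1 / 8)).
  rewrite lt_min; apply/andP; split.
    by rewrite divr_gt0// exprn_gt0.
  by rewrite divr_gt0// mulr_gt0// exprn_gt0.
set d := Num.min _ _.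
have dl : d <= e ^+ 2 / 64 by rewrite /d ge_min lexx.
have dr : d <= e ^+ 2 * d1 / 8 by rewrite /d ge_min lexx orbT.
move=> x y; wlog xy : x y / `|y| <= `|x|.
  move=> H xM yM exy; have [yx|/ltW xy] := leP `|y| `|x|; first exact: H.
  rewrite addrC [X in _ * X]addrC; apply: H => //.
  by rewrite distrC.
move=> xM yM exy.
set s := `|x|; set t := `|y|.
have s0 : 0 <= s by exact: normr_ge0.
have t0 : 0 <= t by exact: normr_ge0.
have est : e <= s + t by rewrite (le_trans exy)// ler_normB.
rewrite -/s -/t in xM yM xy.
have nE : `|2^-1 *: (x + y)| = `|x + y| / 2.
  by rewrite normrZ ger0_norm// mulrC.
have n0 : 0 <= `|x + y| by exact: normr_ge0.
rewrite nE.
have [st|st] := leP (e / 4) (s - t).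
  have nst : `|x + y| <= s + t by exact: ler_normD.
  have : `|x + y| ^+ 2 <= (s + t) ^+ 2 by rewrite ler_sqr ?nnegrE// addr_ge0.
  have : (e / 4) ^+ 2 <= (s - t) ^+ 2.
    by rewrite ler_sqr ?nnegrE//; lra.
  nra.
have et : e / 4 <= t by lra.
have es : e / 2 <= s by lra.
have tp : 0 < t by lra.
have sp : 0 < s by lra.
pose x' := s^-1 *: x; pose y' := t^-1 *: y.
have nx' : `|x'| = 1.
  by rewrite normrZ normfV (ger0_norm s0) mulVf// gt_eqF.
have ny' : `|y'| = 1.
  by rewrite normrZ normfV (ger0_norm t0) mulVf// gt_eqF.
have xE : x = s *: x' by rewrite scalerA mulfV ?scale1r// gt_eqF.
have yE : y = t *: y' by rewrite scalerA mulfV ?scale1r// gt_eqF.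
clearbody x' y'.
have exy' : e / (2 * M) <= `|x' - y'|.
  have h1 : `|x - y| <= s * `|x' - y'| + (s - t).
    have -> : x - y = s *: (x' - y') + (s - t) *: y'.
      by rewrite scalerBr scalerBl addrA subrK -xE -yE.
    rewrite (le_trans (ler_normD _ _))// !normrZ ny' mulr1 (ger0_norm s0).
    by rewrite ger0_norm// subr_ge0.
  have h2 : s * `|x' - y'| <= M * `|x' - y'| by rewrite ler_wpM2r.
  rewrite ler_pdivrMr ?mulr_gt0//; nra.
have := dP _ _ nx' ny' exy'.
rewrite normrZ ger0_norm// => mid.
(* Only the common length [t] profits from the midpoint estimate; the excess [s - t] enters by the
   triangle inequality. *)
have nst : `|x + y| <= s + t - 2 * t * d1.
  have -> : x + y = t *: (x' + y') + (s - t) *: x'.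
    by rewrite scalerDr scalerBl [RHS]addrC addrA subrK -xE -yE.
  rewrite (le_trans (ler_normD _ _))// !normrZ nx' mulr1 (ger0_norm t0).
  rewrite [X in _ + X]ger0_norm ?subr_ge0//.
  have : t * `|x' + y'| <= t * (2 * (1 - d1)) by rewrite ler_wpM2l//; lra.
  lra.
have sq : `|x + y| ^+ 2 <= (s + t - 2 * t * d1) ^+ 2.
  by rewrite ler_sqr ?nnegrE//; lra.
have td : t * d1 <= t by rewrite ler_piMr.
have tds : e / 4 * (e / 2) <= t * s by rewrite ler_pM//; lra.
have tdd : d1 * (e / 4 * (e / 2)) <= d1 * (t * s) by rewrite ler_wpM2l// ltW.
have tdt : 0 <= t * d1 * (t - t * d1).
  by rewrite mulr_ge0 ?mulr_ge0 ?subr_ge0// ltW.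
have := sqr_ge0 (s - t).
nra.
Qed.

(** * Dual pairing, completeness and minimization *)

Lemma dual_argD (R : realType) (X : normedModType R) (f : dual X) (x y : X) :
  f (x + y) = f x + f y.
Proof. exact: linearD. Qed.

Lemma dual_argB (R : realType) (X : normedModType R) (f : dual X) (x y : X) :
  f (x - y) = f x - f y.
Proof. exact: linearB. Qed.

Lemma dual_argN (R : realType) (X : normedModType R) (f : dual X) (x : X) :
  f (- x) = - f x.
Proof. exact: linearN. Qed.

Lemma dual_argZ (R : realType) (X : normedModType R) (f : dual X) (k : R) (x : X) :
  f (k *: x) = k * f x.
Proof. exact: linearZ. Qed.

Lemma dual_pair_le (R : realType) (X : normedModType R) (f : dual X) (x : X) :
  `|f x| <= `|f| * `|x|.
Proof. exact: dual_norm_bound. Qed.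

Lemma dual_exists (R : realType) (X : normedModType R) (f : X -> R) (C : R) :
  linear f -> 0 <= C -> (forall x, `|f x| <= C * `|x|) ->
  exists2 g : dual X, g =1 f & `|g| <= C.
Proof.
move=> lf C0 fC.
pose L : {linear X -> R} := HB.pack f (GRing.isLinear.Build R X R _ f lf).
have cf : continuous f.
  apply: (@bounded_linear_continuous _ _ _ L); apply/linear_boundedP.
  exists C; rewrite num_real; split=> // r Cr x.
  by rewrite (le_trans (fC x))// ler_wpM2r// ltW.
have fP : f \in @continuous_linear R X by apply/continuous_linearP.
exists (Dual fP) => //; apply: dual_norm_le => x x1.
by rewrite (le_trans (fC x))// ler_piMr.
Qed.

(** A predicate on normed modules, so that it also covers [dual X], which is only given that
    structure. *)
Definition seq_complete (R : realType) (V : normedModType R) :=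
  forall u : nat -> V,
    (forall e : R, 0 < e -> exists N, forall m n,
      (N <= m)%N -> (N <= n)%N -> `|u m - u n| < e) ->
    exists l : V, u n @[n --> \oo] --> l.

Lemma complete_seq_complete (R : realType) (V : completeNormedModType R) :
  seq_complete V.
Proof.
move=> u uC; suff : cvg (u @ \oo) by move=> h; exists (lim (u @ \oo)).
apply/cauchy_cvgP/cauchy_exP => e e0; have [N NP] := uC _ e0.
exists (u N); exists N => // n /= Nn.
by rewrite -ball_normE /=; exact: NP.
Qed.

(** The pointwise limit is linear, and the Cauchy estimate passes to the limit in one index; this
    gives both its boundedness and convergence in norm. *)
Lemma dual_seq_complete (R : realType) (X : normedModType R) :
  seq_complete (dual X).
Proof.
move=> u uC.
have uxC x : exists l : R, u n x @[n --> \oo] --> l.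
  apply: (@complete_seq_complete R R^o) => e e0.
  have x1 : 0 < `|x| + 1 by rewrite ltr_wpDl.
  have [N NP] := uC _ (divr_gt0 e0 x1); exists N => m n Nm Nn.
  rewrite -dualBE (le_lt_trans (dual_pair_le _ _))//.
  have h := NP m n Nm Nn.
  have : `|u m - u n| * (`|x| + 1) < e by rewrite -ltr_pdivlMr.
  by apply: le_lt_trans; rewrite ler_wpM2l// lerDl.
pose f x := sval (cid (uxC x)).
have fP x : u n x @[n --> \oo] --> f x by rewrite /f; case: cid.
have flin : linear f.
  move=> k x y; rewrite -(cvg_lim _ (fP (k *: x + y)))//.
  apply: cvg_lim => //; under eq_fun do rewrite linearP.
  by apply: cvgD; [apply: cvgZr; exact: fP|exact: fP].
have close e : 0 < e -> exists N, forall n, (N <= n)%N ->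
    forall x, `|f x - u n x| <= e * `|x|.
  move=> e0; have [N NP] := uC _ e0; exists N => n Nn x.
  have hc : `|u m x - u n x| @[m --> \oo] --> `|f x - u n x|.
    by apply: cvg_norm; apply: cvgB; [exact: fP|exact: cvg_cst].
  rewrite -(cvg_lim _ hc)//; apply: limr_le; first by apply/cvg_ex; exists (`|f x - u n x|).
  exists N => // m /= Nm.
  rewrite -dualBE (le_trans (dual_pair_le _ _))// ler_wpM2r//.
  exact: ltW (NP m n Nm Nn).
have [N NP] := close _ ltr01.
have fb x : `|f x| <= (`|u N| + 1) * `|x|.
  rewrite -(subrK (u N x) (f x)) (le_trans (ler_normD _ _))// mulrDl addrC.
  by rewrite lerD ?dual_pair_le// NP.
have [g gf _] := dual_exists flin (addr_ge0 (normr_ge0 _) ler01) fb.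
exists g; apply/cvgrPdist_le => e e0.
have [n0 n0P] := close _ e0; exists n0 => // n /= n0n.
apply: dual_norm_le => x x1; rewrite dualBE gf.
by rewrite (le_trans (n0P _ n0n x))// ler_piMr// ltW.
Qed.

Lemma prod_seq_complete (R : realType) (V W : normedModType R) :
  seq_complete V -> seq_complete W -> seq_complete (V * W)%type.
Proof.
move=> cV cW u uC.
have [|v uv] := cV (fun n => (u n).1).
  move=> e /uC[N NP]; exists N => m n Nm Nn.
  have := NP m n Nm Nn; apply: le_lt_trans.
  by rewrite prod_normE le_max lexx.
have [|w uw] := cW (fun n => (u n).2).
  move=> e /uC[N NP]; exists N => m n Nm Nn.
  have := NP m n Nm Nn; apply: le_lt_trans.
  by rewrite prod_normE le_max lexx orbT.
exists (v, w).
rewrite (_ : u = fun n => ((u n).1, (u n).2)); last first.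
  by apply/funext => n; case: (u n).
exact: cvg_pair.
Qed.

(* [S] is the family of sublevel sets [{g <= r}] of a function [g] that may
   take the value [+oo]. *)
Lemma minimizer_exists (R : realType) (V : normedModType R) (S : R -> set V)
    (c : R) :
  seq_complete V ->
  (forall r s, r <= s -> S r `<=` S s) ->
  (forall r z, (forall s, r < s -> S s z) -> S r z) ->
  (forall r, closed (S r)) ->
  (forall r, S r !=set0 -> c <= r) ->
  (exists r, S r !=set0) ->
  (forall r e, 0 < e -> exists2 d, 0 < d & forall s z w, s <= r ->
     S s z -> S s w -> e <= `|z - w| -> S (s - d) !=set0) ->
  exists m z, S m z /\ forall r, S r !=set0 -> m <= r.
Proof.
move=> cV Smono Scap Scl Slb [r0 Sr0] Suc.
pose E := [set r | S r !=set0].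
have Einf : has_inf E by split; [exists r0|exists c => r; exact: Slb].
pose m := inf E.
have mE r : S r !=set0 -> m <= r.
  by move=> Sr; apply: ge_inf => //; exact: Einf.2.
have near_m e : 0 < e -> S (m + e) !=set0.
  move=> e0; have [r Er rm] := inf_adherent e0 Einf.
  by have [z Sz] := Er; exists z; apply: Smono Sz; exact: ltW.
pose v (n : nat) := m + n.+1%:R^-1.
have /choice[u uP] : forall n, exists z, S (v n) z.
  by move=> n; apply: near_m; rewrite invr_gt0 ltr0n.
have small d : 0 < d -> exists N, forall n, (N <= n)%N -> v n < m + d.
  move=> d0; have [N _ NP] := near_infty_natSinv_lt (PosNum d0).
  by exists N => n Nn; rewrite ltrD2l; exact: NP.
have [|z uz] := cV u.
  (* The gap [d] must be fixed before [N], hence the level [m + 1]. Two late terms at distance [e]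
     would yield a point at level [v N - d], below the infimum [m]. *)
  move=> e e0; have [d d0 dP] := Suc (m + 1) _ e0.
  have [N NP] := small (Num.min d 1) ltac:(by rewrite lt_min d0 ltr01).
  exists N => i j Ni Nj; rewrite ltNge; apply/negP => eij.
  have vN := NP N (leqnn _).
  have vd : v N < m + d.
    by rewrite (lt_le_trans vN)// lerD2l ge_min lexx.
  have v1 : v N <= m + 1.
    by rewrite (le_trans (ltW vN))// lerD2l ge_min lexx orbT.
  have vmono k : (N <= k)%N -> v k <= v N.
    by move=> Nk; rewrite lerD2l lef_pV2 ?posrE ?ltr0n// ler_nat.
  have := dP (v N) (u i) (u j) v1 (Smono _ _ (vmono _ Ni) _ (uP i))
    (Smono _ _ (vmono _ Nj) _ (uP j)) eij.
  by move/mE; lra.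
exists m, z; split => //; apply: Scap => s ms.
have [N NP] := small (s - m) ltac:(by rewrite subr_gt0).
apply: (closed_cvg (S s) (Scl s) _ z uz).
exists N => // n /= Nn; apply: Smono (uP n); apply: ltW.
by have := NP _ Nn; rewrite addrC subrK.
Qed.

(** * Hahn-Banach *)

Section hahn_banach.
Context (R : realType) (X : normedModType R).

(* A set of pairs that is closed under linear combinations and on which
   [r <= `|x|] is automatically the graph of a linear functional: apply the
   bound to [(0, r)] and [(0, - r)]. *)
Definition norm_dominated (G : set (X * R)) :=
  (forall k u v, G u -> G v -> G (k *: u + v)) /\
  (forall u, G u -> u.2 <= `|u.1|).

Lemma norm_dominated_inj G x r s :
  norm_dominated G -> G (x, r) -> G (x, s) -> r = s.
Proof.
move=> [Glin Gle].
suff le_ a b : G (x, a) -> G (x, b) -> b <= a.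
  by move=> xr xs; apply/eqP; rewrite eq_le !le_.
move=> xa xb; have /Gle := Glin (- 1) _ _ xa xb.
by rewrite /= !scaleN1r addNr normr0 addrC subr_le0.
Qed.

(** The one-dimensional Hahn-Banach step: by the triangle inequality the lower bounds on the value
    [c] at [x] lie below the upper bounds, so their supremum works. *)
Lemma norm_dominated_extend G u0 x :
  norm_dominated G -> G u0 -> exists c : R,
  norm_dominated
    [set u | exists2 v, G v & exists k : R, u = v + k *: (x, c)].
Proof.
move=> [Glin Gle] Gu0.
pose E := [set v.2 - `|v.1 - x| | v in G].
have Eub v : G v -> ubound E (`|v.1 + x| - v.2).
  move=> Gv _ [w Gw <-].
  have := Gle _ (Glin 1 _ _ Gv Gw); rewrite !scale1r /= => vw.
  have : `|v.1 + w.1| <= `|v.1 + x| + `|w.1 - x|.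
    apply: le_trans (ler_normD _ _).
    by rewrite addrACA subrr addr0.
  lra.
have Esup : has_sup E.
  by split; [exists (u0.2 - `|u0.1 - x|), u0|exists (`|u0.1 + x| - u0.2); exact: Eub].
pose c := sup E.
have G0 : G 0 by have := Glin (- 1) _ _ Gu0 Gu0; rewrite scaleN1r addNr.
have Gscale k v : G v -> G (k *: v).
  by move=> Gv; have := Glin k _ _ Gv G0; rewrite addr0.
have cub v : G v -> c <= `|v.1 + x| - v.2.
  by move=> Gv; apply: ge_sup; [exact: Esup.1|exact: Eub].
have clb v : G v -> v.2 - `|v.1 - x| <= c.
  by move=> Gv; apply: ub_le_sup; [exact: Esup.2|exists v].
exists c; split.
  move=> k _ _ [v Gv [a ->]] [w Gw [b ->]].
  exists (k *: v + w); first exact: Glin.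
  exists (k * a + b).
  by rewrite scalerDr scalerA addrACA -scalerDl.
move=> _ [v Gv [k ->]] /=.
have [k0|k0|->] := ltgtP k 0; last by rewrite !scale0r !addr0 Gle.
- have l0 : 0 < - k by rewrite oppr_gt0.
  have := clb _ (Gscale (- k)^-1 _ Gv) => /=.
  have -> : `|(- k)^-1 *: v.1 - x| = (- k)^-1 * `|v.1 + k *: x|.
    rewrite -[X in X * _]gtr0_norm ?invr_gt0// -normrZ scalerDr scalerA.
    by rewrite invrN mulNr mulVf ?scaleN1r// lt_eqF.
  rewrite -[_ *: v.2]/(_ * v.2) -mulrBr mulrC ler_pdivrMr//.
  by rewrite -[_ *: c]/(_ * c); lra.
- have := cub _ (Gscale k^-1 _ Gv) => /=.
  have -> : `|k^-1 *: v.1 + x| = k^-1 * `|v.1 + k *: x|.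
    rewrite -[X in X * _]gtr0_norm ?invr_gt0// -normrZ scalerDr scalerA.
    by rewrite mulVf ?scale1r// gt_eqF.
  rewrite -[_ *: v.2]/(_ * v.2) -mulrBr [X in _ <= X]mulrC ler_pdivlMr//.
  by rewrite -[_ *: c]/(_ * c); lra.
Qed.

(** A maximal norm-dominated graph through [p] and its norm is total by the one-dimensional
    extension; the functional obtained is then scaled by the norm of [p]. *)
Lemma norming_functional (p : X) :
  exists f : dual X, f p = `|p| ^+ 2 /\ `|f| = `|p|.
Proof.
have [->|p0] := eqVneq p 0.
  by exists 0; rewrite !normr0 dual0E expr0n.
have np0 : 0 < `|p| by rewrite normr_gt0.
(* The union of the empty chain must satisfy [P] too, so the point is required only of nonempty
   graphs. *)
pose P G := norm_dominated G /\ (G !=set0 -> G (p, `|p|)).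
have [F FP Ftot|G [[[Glin Gle] Gp] Gmax]] := @Zorn_bigcup (X * R)%type P.
  split; first split.
  - move=> k u v [G FG Gu] [H FH Hv].
    have [GH|HG] := Ftot _ _ FG FH.
    + by exists H => //; apply: (FP _ FH).1.1 => //; exact: GH.
    + by exists G => //; apply: (FP _ FG).1.1 => //; exact: HG.
  - by move=> u [G FG Gu]; exact: (FP _ FG).1.2.
  - by move=> [u [G FG Gu]]; exists G => //; apply: (FP _ FG).2; exists u.
(* An empty maximal graph would be properly contained in the line through this point. *)
have {}Gp : G (p, `|p|).
  apply: contrapT => nGp.
  have Ge u : ~ G u by move=> Gu; apply: nGp; apply: Gp; exists u.
  apply: (Gmax [set u | exists k : R, u = k *: (p, `|p|)]).
    split; first by move=> u /Ge.
    by move=> /(_ (p, `|p|)) h; apply/nGp/h; exists 1; rewrite scale1r.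
  split; first split.
  - by move=> k _ _ [a ->] [b ->]; exists (k * a + b); rewrite scalerDl scalerA.
  - move=> _ [k ->] /=; rewrite normrZ -[_ *: `|p|]/(_ * `|p|).
    by rewrite ler_wpM2r// ler_norm.
  - by move=> _; exists 1; rewrite scale1r.
have Gdom x : exists r, G (x, r).
  have [c cP] := norm_dominated_extend x (conj Glin Gle) Gp.
  set H := [set u | _] in cP.
  have GH : G `<=` H by move=> u Gu; exists u => //; exists 0; rewrite scale0r addr0.
  have HG : H `<=` G.
    apply: contrapT => nHG; apply: (Gmax H); first by split.
    by split=> // _; exact: GH.
  exists c; apply: HG; exists 0; last by exists 1; rewrite scale1r add0r.
  by have := Glin (- 1) _ _ Gp Gp; rewrite scaleN1r addNr.
pose f x := sval (cid (Gdom x)).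
have fP x : G (x, f x) by rewrite /f; case: cid.
have G0 : G 0 by have := Glin (- 1) _ _ Gp Gp; rewrite scaleN1r addNr.
have flin : linear f.
  move=> k x y; apply: (@norm_dominated_inj G (k *: x + y)) => //.
  exact: (Glin k _ _ (fP x) (fP y)).
have fle x : `|f x| <= 1 * `|x|.
  rewrite mul1r ler_norml; apply/andP; split; last exact: (Gle _ (fP x)).
  have := Gle _ (Glin (- 1) _ _ (fP x) G0).
  by rewrite addr0 scaleN1r /= normrN lerNl.
have [g gf g1] := dual_exists flin ler01 fle.
have fp : f p = `|p| by exact: norm_dominated_inj (fP p) Gp.
exists (`|p| *: g); split; first by rewrite dualZE gf fp expr2.
apply/eqP; rewrite normrZ normr_id eq_le ler_piMr//=.
rewrite -{1}[`|p|]mulr1 ler_pM2l//.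
have := dual_pair_le g p; rewrite gf fp normr_id -{1}[`|p|]mul1r.
by rewrite ler_pM2r.
Qed.

End hahn_banach.

(** * Duality maps and smoothness of the norms *)

Lemma dual_young (R : realType) (X : normedModType R) (f : dual X) (x : X) :
  f x <= 2^-1 * `|x| ^+ 2 + 2^-1 * `|f| ^+ 2.
Proof.
have := le_trans (ler_norm _) (dual_pair_le f x).
have := sqr_ge0 (`|x| - `|f|); nra.
Qed.

Lemma closed_sublevel_affine_half_sqr (R : realType) (X : normedModType R)
    (f : dual X) (c r : R) :
  closed [set x : X | 2^-1 * `|x| ^+ 2 - f x + c <= r].
Proof.
apply: (@preimage_closed _ _ (fun x : X => 2^-1 * `|x| ^+ 2 - f x + c)
  [set y | y <= r]); last exact: closed_le.
move=> x _; apply: cvgD; last exact: cvg_cst.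
apply: cvgB; last exact: dual_continuous.
apply: cvgM; first exact: cvg_cst.
by apply: cvgM; apply: cvg_norm; exact: cvg_id.
Qed.

(** The defect in Young's inequality has infimum 0, approached along almost norming vectors rescaled
    by the norm of [f]. It attains this infimum by uniform convexity, and equality in Young's
    inequality forces both claims. *)
Lemma norm_attained (R : realType) (X : normedModType R) :
  seq_complete X -> uniformly_convex X ->
  forall f : dual X, exists q : X, f q = `|f| ^+ 2 /\ `|q| = `|f|.
Proof.
move=> cX ucX f.
pose S r := [set x : X | 2^-1 * `|x| ^+ 2 - f x + 2^-1 * `|f| ^+ 2 <= r].
have S0 r : S r !=set0 -> 0 <= r.
  by move=> [x]; rewrite /S /=; have := dual_young f x; lra.
have Sne e : 0 < e -> S e !=set0.
  move=> e0; have f1 : 0 < `|f| + 1 by rewrite ltr_wpDl.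
  have [_ [x x1 <-]] := sup_adherent (divr_gt0 e0 f1) (dual_norm_has_sup f).
  rewrite -/(dual_norm f) -[dual_norm f]/`|f| => fx.
  have {fx} : exists2 y, `|y| <= 1 & `|f| - e / (`|f| + 1) < f y.
    have [fx0|fx0] := leP 0 (f x); first by exists x; rewrite // -(ger0_norm fx0).
    by exists (- x); rewrite ?normrN// dual_argN -(ltr0_norm fx0).
  move=> [y y1 fy]; exists (`|f| *: y); rewrite /S /= normrZ normr_id dual_argZ.
  have ef : e / (`|f| + 1) * `|f| <= e.
    by rewrite -mulrAC ler_pdivrMr// ler_wpM2l ?lerDl// ltW.
  have : (`|f| * `|y|) ^+ 2 <= `|f| ^+ 2.
    by rewrite ler_sqr ?nnegrE ?mulr_ge0// ler_piMr.
  have : `|f| * (`|f| - e / (`|f| + 1)) <= `|f| * f y by rewrite ler_wpM2l// ltW.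
  nra.
have [||||||m [q [Smq Smin]]] := @minimizer_exists _ _ S 0 cX.
- by move=> r s rs x; rewrite /S /= => /le_trans; apply.
- by move=> r x Sx; apply/ler_addgt0Pr => s s0; apply: Sx; rewrite ltrDl.
- by move=> r; exact: closed_sublevel_affine_half_sqr.
- exact: S0.
- by exists 1; exact: Sne.
(* On [S r] the squared difference of the norms of [z] and [f] is at most [2 * r], so [M] bounds
   [z]. *)
- move=> r e e0; pose M := `|f| + 1 + 2 * `|r|.
  have M0 : 0 < M by rewrite ltr_wpDr ?mulr_ge0// ltr_wpDl.
  have [d d0 dP] := uniformly_convex_sqr ucX M0 e0.
  exists (2^-1 * d); first by rewrite mulr_gt0.
  have SM s z : s <= r -> S s z -> `|z| <= M.
    rewrite /S /= => sr Sz; rewrite leNgt /M; apply/negP => Mz.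
    have := le_trans (ler_norm _) (dual_pair_le f z).
    have := ler_norm r; have := normr_ge0 r.
    by have := normr_ge0 f; nra.
  move=> s z w sr Sz Sw ezw; exists (2^-1 *: (z + w)).
  have := dP _ _ (SM _ _ sr Sz) (SM _ _ sr Sw) ezw.
  by move: Sz Sw; rewrite /S /= dual_argZ dual_argD; nra.
have {Smin} m0 : m <= 0.
  by apply/ler_addgt0Pr => e e0; rewrite add0r; exact: Smin (Sne _ e0).
exists q; move: Smq; rewrite /S /= => Smq.
have fq := le_trans (ler_norm _) (dual_pair_le f q).
have qf : `|q| = `|f|.
  apply/eqP; rewrite -subr_eq0 -sqrf_eq0; apply/eqP/le_anti.
  by rewrite sqr_ge0 andbT; nra.
split=> //; apply/le_anti; move: fq Smq; rewrite qf -expr2; lra.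
Qed.

(* Stated for an abstract pairing so as to serve both [X] paired with its dual
   and the dual paired with [X]; [w] is the value at [v] of the duality map. *)
Lemma half_sqr_norm_smooth (R : realType) (V W : normedModType R)
    (b : V -> W -> R) :
  (forall v h t w, b (v + t *: h) w = b v w + t * b h w) ->
  (forall v w w', b v (2^-1 *: (w + w')) = 2^-1 * (b v w + b v w')) ->
  (forall v w w', b v (w - w') = b v w - b v w') ->
  (forall v w, `|b v w| <= `|v| * `|w|) ->
  uniformly_convex W ->
  (forall v, exists w, b v w = `|v| ^+ 2 /\ `|w| = `|v|) ->
  forall v h w e, b v w = `|v| ^+ 2 -> `|w| = `|v| -> 0 < e ->
  exists2 d, 0 < d <= 1 & forall t, 0 < t <= d ->
    2^-1 * `|v + t *: h| ^+ 2 <= 2^-1 * `|v| ^+ 2 + t * (b h w + e).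
Proof.
move=> bV bmid bW ble ucW bdual v h w e bvw wv e0.
have young v' w' : b v' w' <= 2^-1 * `|v'| ^+ 2 + 2^-1 * `|w'| ^+ 2.
  have := le_trans (ler_norm _) (ble v' w').
  by have := sqr_ge0 (`|v'| - `|w'|); nra.
have h1 : 0 < `|h| + 1 by rewrite ltr_wpDl.
pose e' := e / (`|h| + 1); have e'0 : 0 < e' by rewrite divr_gt0.
pose M := `|v| + `|h| + 1.
have M0 : 0 < M by rewrite ltr_wpDl// addr_ge0.
have [d d0 dP] := uniformly_convex_sqr ucW M0 e'0.
pose C := 2 * M * `|h| + 1.
have C0 : 0 < C by rewrite ltr_wpDl// !mulr_ge0// ltW.
exists (Num.min 1 (d / C)).
  by rewrite lt_min ltr01 divr_gt0// ge_min lexx.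
move=> t /andP[t0]; rewrite le_min => /andP[t1 td].
have [wt [bwt nwt]] := bdual (v + t *: h).
have nvt : `|v + t *: h| <= M.
  rewrite (le_trans (ler_normD _ _))// normrZ gtr0_norm//.
  have : t * `|h| <= `|h| by rewrite ler_piMl.
  by rewrite /M; lra.
have wtM : `|wt| <= M by rewrite nwt.
have wM : `|w| <= M by rewrite wv /M; have := normr_ge0 h; lra.
have bvt : b v wt = `|v + t *: h| ^+ 2 - t * b h wt.
  by rewrite -bwt bV addrK.
(* Continuity of the duality map: if [wt] and [w] were [e'] apart, Young's inequality at their
   midpoint would gain [d], while both norm their vectors up to order [t]; this contradicts
   [t <= d / C]. *)
have dist : `|wt - w| < e'.
  rewrite ltNge; apply/negP => ewt.
  have := dP _ _ wtM wM ewt.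
  have := young v (2^-1 *: (wt + w)); rewrite bmid bvw bvt nwt wv => y1 y2.
  have := young (v + t *: h) w; rewrite bV bvw wv => y3.
  have y4 : b h wt - b h w <= `|h| * (M + M).
    rewrite -bW (le_trans (ler_norm _))// (le_trans (ble _ _))//.
    by rewrite ler_wpM2l// (le_trans (ler_normB _ _))// lerD.
  have y5 : t * (b h wt - b h w) <= t * (`|h| * (M + M)) by rewrite ler_pM2l.
  have y6 : t * C <= d by rewrite -ler_pdivlMr.
  move: y6; rewrite /C; nra.
have bh : b h wt <= b h w + e.
  rewrite -lerBlDl -bW (le_trans (ler_norm _))// (le_trans (ble _ _))//.
  have : `|h| * `|wt - w| <= `|h| * e' by rewrite ler_wpM2l// ltW.
  have : (`|h| + 1) * e' = e by rewrite mulrC divfK// gt_eqF.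
  lra.
(* Young's inequality makes [wt] a subgradient at the moved point, so the increment is at most
   [t * b h wt]. *)
have : t * b h wt <= t * (b h w + e) by rewrite ler_pM2l.
by have := young v wt; rewrite bvt nwt; lra.
Qed.

Lemma half_sqr_norm_smooth_primal (R : realType) (X : normedModType R) :
  uniformly_convex (dual X) ->
  forall (v h : X) (w : dual X) e, w v = `|v| ^+ 2 -> `|w| = `|v| -> 0 < e ->
  exists2 d, 0 < d <= 1 & forall t, 0 < t <= d ->
    2^-1 * `|v + t *: h| ^+ 2 <= 2^-1 * `|v| ^+ 2 + t * (w h + e).
Proof.
move=> ucX; apply: (@half_sqr_norm_smooth _ _ _ (fun v (w : dual X) => w v)) => //.
- by move=> v h t w; rewrite dual_argD dual_argZ.
- by move=> v w; rewrite mulrC dual_pair_le.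
- exact: norming_functional.
Qed.

Lemma half_sqr_norm_smooth_dual (R : realType) (X : normedModType R) :
  seq_complete X -> uniformly_convex X ->
  forall (v h : dual X) (w : X) e, v w = `|v| ^+ 2 -> `|w| = `|v| -> 0 < e ->
  exists2 d, 0 < d <= 1 & forall t, 0 < t <= d ->
    2^-1 * `|v + t *: h| ^+ 2 <= 2^-1 * `|v| ^+ 2 + t * (h w + e).
Proof.
move=> cX ucX; apply: (@half_sqr_norm_smooth _ _ _ (fun (v : dual X) w => v w)) => //.
- by move=> v w w'; rewrite dual_argZ dual_argD.
- by move=> v w w'; rewrite dual_argB.
- exact: dual_pair_le.
- exact: norm_attained.
Qed.

(** * Maximal monotone operators *)

(** Adjoining [(p, g)] to the graph keeps it monotone, so maximality forbids that it is new. *)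
Lemma maximal_monotone_in (R : realType) (X : normedModType R)
    (A : X -> set (dual X)) (p : X) (g : dual X) :
  maximal_monotone A ->
  (forall a f, A a f -> 0 <= (g - f) (p - a)) -> A p g.
Proof.
move=> [Amon Amax] pg; apply: contrapT => nApg.
apply: (Amax (fun x => A x `|` [set f | x = p /\ f = g])); last first.
  split; first by move=> [x f] /= Axf; left.
  by move=> /(_ (p, g)) h; apply/nApg/h; right.
move=> x y f h [Ax|[-> ->]] [Ay|[-> ->]].
- exact: Amon.
- by have := pg _ _ Ax; rewrite !(dualBE, dual_argB); lra.
- exact: pg.
- by rewrite subrr dual0E.
Qed.

(** The left side is the term whose supremum over the graph is the Fitzpatrick function at [(p, g)];
    the right side exposes the monotonicity pairing. *)
Lemma fitzpatrick_termE (R : realType) (X : normedModType R)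
    (f g : dual X) (a p : X) :
  f p + g a - f a = g p - (g - f) (p - a).
Proof. by rewrite !(dualBE, dual_argB); lra. Qed.

Lemma dual_eval_continuous (R : realType) (X : normedModType R) (a : X) :
  continuous (fun g : dual X => g a).
Proof.
have [|g|G Ga _] := @dual_exists _ _ (fun g : dual X => g a) `|a| _ (normr_ge0 a).
- by move=> k g h.
- by rewrite mulrC dual_pair_le.
- by have <- : (G : dual X -> R) = (fun g : dual X => g a);
    [apply/funext|exact: dual_continuous].
Qed.

Lemma sqr_norm_midpoint (R : realType) (V : normedModType R) (x y : V) :
  `|2^-1 *: (x + y)| ^+ 2 <= 2^-1 * (`|x| ^+ 2 + `|y| ^+ 2).
Proof.
rewrite normrZ ger0_norm//.
have : `|x + y| ^+ 2 <= (`|x| + `|y|) ^+ 2.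
  by rewrite ler_sqr ?nnegrE ?addr_ge0// ler_normD.
by have := sqr_ge0 (`|x| - `|y|); nra.
Qed.

(** * Rockafellar's theorem through the Fitzpatrick function *)

Section rockafellar.
Context (R : realType) (X : normedModType R) (A : X -> set (dual X)).
Context (cX : seq_complete X) (X_uc : uniformly_convex X)
  (dualX_uc : uniformly_convex (dual X)).
Context (A_mon : monotone_operator A)
  (A_max : forall p g, (forall a f, A a f -> 0 <= (g - f) (p - a)) -> A p g).
Context (A_neq0 : exists a f, A a f).

(* The sublevel sets of the Fitzpatrick function of [A] plus the half squared
   norm [`|x| ^+ 2 / 2 + `|x^*| ^+ 2 / 2]. *)
Let S r := [set z : X * dual X | forall a f, A a f ->
  f z.1 + z.2 a - f a + (2^-1 * `|z.1| ^+ 2 + 2^-1 * `|z.2| ^+ 2) <= r].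

Lemma fitzpatrick_sublevel_closed r : closed (S r).
Proof.
have -> : S r = \bigcap_(af in [set af : X * dual X | A af.1 af.2])
    [set z : X * dual X | af.2 z.1 + z.2 af.1 - af.2 af.1 +
      (2^-1 * `|z.1| ^+ 2 + 2^-1 * `|z.2| ^+ 2) <= r].
  apply/seteqP; split=> [z Sz [a f] /= Aaf|z Sz a f Aaf]; first exact: Sz.
  exact: (Sz (a, f)).
apply: closed_bigI => -[a f] /= _.
apply: (@preimage_closed _ _ (fun z : X * dual X => f z.1 + z.2 a - f a +
      (2^-1 * `|z.1| ^+ 2 + 2^-1 * `|z.2| ^+ 2))
  [set y | y <= r]); last exact: closed_le.
move=> z _.
have c1 : y.1 @[y --> z] --> z.1 by exact: cvg_fst.
have c2 : y.2 @[y --> z] --> z.2 by exact: cvg_snd.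
apply: cvgD.
  apply: cvgB; last exact: cvg_cst.
  apply: cvgD.
    by apply: continuous_cvg => //; exact: dual_continuous.
  exact: (cvg_comp _ _ c2 (@dual_eval_continuous _ _ a z.2)).
by apply: cvgD; (apply: cvgM; first exact: cvg_cst); apply: cvgM; exact: cvg_norm.
Qed.

(** The Fitzpatrick function dominates the pairing: otherwise [z] would be strictly monotonically
    related to the whole graph, hence belong to it, and then to itself. *)
Lemma fitzpatrick_ge r z : S r z ->
  z.2 z.1 + (2^-1 * `|z.1| ^+ 2 + 2^-1 * `|z.2| ^+ 2) <= r.
Proof.
move=> Sz; rewrite leNgt; apply/negP => rz.
have pos a f : A a f -> 0 < (z.2 - f) (z.1 - a).
  by move=> /Sz; rewrite fitzpatrick_termE; lra.
have /pos : A z.1 z.2 by apply: A_max => a f /pos/ltW.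
by rewrite subrr dual0E ltxx.
Qed.

Lemma fitzpatrick_minimizer :
  exists m z, S m z /\ forall r, S r !=set0 -> m <= r.
Proof.
have [a0 [f0 Aaf0]] := A_neq0.
apply: (@minimizer_exists _ _ S 0).
- by apply: prod_seq_complete => //; exact: dual_seq_complete.
- by move=> r s rs z Sz a f /Sz/le_trans; apply.
- move=> r z Sz a f Aaf; apply/ler_addgt0Pr => s s0.
  by apply: Sz => //; rewrite ltrDl.
- exact: fitzpatrick_sublevel_closed.
- move=> r [z /fitzpatrick_ge]; apply: le_trans.
  have := dual_young z.2 (- z.1).
  by rewrite dual_argN normrN; lra.
- exists (f0 a0 + (2^-1 * `|a0| ^+ 2 + 2^-1 * `|f0| ^+ 2)), (a0, f0) => a f Aaf /=.
  rewrite fitzpatrick_termE lerD2r lerBlDr lerDl.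
  exact: A_mon.
- move=> r e e0.
  (* Completing squares in the constraint at the single graph point [(a0, f0)] bounds both
     components by [M]. *)
  pose K := r + f0 a0 + 2^-1 * `|f0| ^+ 2 + 2^-1 * `|a0| ^+ 2.
  pose M := `|f0| + `|a0| + 1 + 2 * `|K|.
  have M0 : 0 < M by rewrite ltr_wpDr ?mulr_ge0// ltr_wpDl// addr_ge0.
  have [d1 d10 d1P] := uniformly_convex_sqr X_uc M0 e0.
  have [d2 d20 d2P] := uniformly_convex_sqr dualX_uc M0 e0.
  pose d := Num.min d1 d2.
  have d0 : 0 < d by rewrite lt_min d10.
  have dd1 : d <= d1 by rewrite ge_min lexx.
  have dd2 : d <= d2 by rewrite ge_min lexx orbT.
  have bound (u v : R) : 0 <= u -> (u - v) ^+ 2 <= 2 * K -> u <= v + 1 + 2 * `|K|.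
    move=> u0 uv; rewrite leNgt; apply/negP => vu.
    by have := ler_norm K; have := normr_ge0 K; nra.
  have SM s z : s <= r -> S s z -> `|z.1| <= M /\ `|z.2| <= M.
    move=> sr /(_ _ _ Aaf0) Sz.
    have h1 := le_trans (ler_norm _) (dual_pair_le f0 (- z.1)).
    have h2 := le_trans (ler_norm _) (dual_pair_le (- z.2) a0).
    rewrite dual_argN normrN in h1; rewrite dualNE normrN in h2.
    have sum : (`|z.1| - `|f0|) ^+ 2 + (`|z.2| - `|a0|) ^+ 2 <= 2 * K.
      by rewrite /K; nra.
    have s1 := sqr_ge0 (`|z.1| - `|f0|).
    have s2 := sqr_ge0 (`|z.2| - `|a0|).
    split.
      rewrite (le_trans (bound _ `|f0| _ _))//; first by lra.
      by rewrite /M !lerD2r lerDl.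
    rewrite (le_trans (bound _ `|a0| _ _))//; first by lra.
    by rewrite /M !lerD2r lerDr.
  exists (2^-1 * d); first by rewrite mulr_gt0.
  move=> s z w sr Sz Sw ezw.
  have [z1 z2] := SM _ _ sr Sz; have [w1 w2] := SM _ _ sr Sw.
  have mid : `|2^-1 *: (z.1 + w.1)| ^+ 2 + `|2^-1 *: (z.2 + w.2)| ^+ 2 <=
      2^-1 * (`|z.1| ^+ 2 + `|w.1| ^+ 2) + 2^-1 * (`|z.2| ^+ 2 + `|w.2| ^+ 2) - d.
    (* The product carries the max norm: one component is separated and supplies the gap, the other
       needs only convexity. *)
    move: ezw; rewrite prod_normE le_max => /orP[/= ezw|/= ezw].
      have := d1P _ _ z1 w1 ezw; have := sqr_norm_midpoint z.2 w.2; lra.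
    have := d2P _ _ z2 w2 ezw; have := sqr_norm_midpoint z.1 w.1; lra.
  exists (2^-1 *: (z.1 + w.1), 2^-1 *: (z.2 + w.2)) => a f Aaf.
  rewrite [_.1]/fst [_.2]/snd.
  have := Sz _ _ Aaf; have := Sw _ _ Aaf; move: mid.
  rewrite dual_argZ dual_argD dualZE dualDE; lra.
Qed.

(* The inequality says that [- f] lies in the duality map at [y]. *)
Lemma rockafellar : exists y f, A y f /\ `|y| ^+ 2 + `|f| ^+ 2 + 2 * f y <= 0.
Proof.
have [m [[p g] [Sm Smin]]] := fitzpatrick_minimizer.
have [j [jp nj]] := norming_functional p.
have [q [gq nq]] := norm_attained cX X_uc g.
pose M := m - (2^-1 * `|p| ^+ 2 + 2^-1 * `|g| ^+ 2).
have gpM : g p <= M by have := fitzpatrick_ge Sm; rewrite /M /=; lra.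
(* First-order condition along the segment from [(p, g)] to [(a, f)]: the Fitzpatrick function is
   convex, at most [M] at the start and at most [f a] at the end, and the squares are
   differentiable. *)
have key a f : A a f -> M <= f a + j (a - p) + (f - g) q.
  move=> Aaf; apply/ler_addgt0Pr => e e0.
  have e20 : 0 < e / 2 by rewrite divr_gt0.
  have [d1 /andP[d10 d11] d1P] :=
    half_sqr_norm_smooth_primal dualX_uc (a - p) jp nj e20.
  have [d2 /andP[d20 _] d2P] :=
    half_sqr_norm_smooth_dual cX X_uc (f - g) gq nq e20.
  pose t := Num.min d1 d2.
  have t0 : 0 < t by rewrite lt_min d10.
  have t1 : t <= d1 by rewrite ge_min lexx.
  have t2 : t <= d2 by rewrite ge_min lexx orbT.
  have {d1P}h1 := d1P t; rewrite t0 t1 in h1; have {}h1 := h1 isT.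
  have {d2P}h2 := d2P t; rewrite t0 t2 in h2; have {}h2 := h2 isT.
  have tle1 : t <= 1 by exact: le_trans t1 d11.
  set v := p + t *: (a - p) in h1; set w := g + t *: (f - g) in h2.
  have : S ((1 - t) * M + t * f a + (2^-1 * `|v| ^+ 2 + 2^-1 * `|w| ^+ 2)) (v, w).
    move=> a' f' Aaf'; rewrite [_.1]/fst [_.2]/snd lerD2r.
    have u1 : f' p + g a' - f' a' <= M by have := Sm _ _ Aaf'; rewrite /M /=; lra.
    have u2 : f' a + f a' - f' a' <= f a.
      by rewrite fitzpatrick_termE lerBlDr lerDl; exact: A_mon.
    have {}u1 : (1 - t) * (f' p + g a' - f' a') <= (1 - t) * M.
      by rewrite ler_wpM2l// subr_ge0.
    have {}u2 : t * (f' a + f a' - f' a') <= t * f a by rewrite ler_pM2l.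
    have -> : f' v = f' p + t * (f' a - f' p).
      by rewrite dual_argD dual_argZ dual_argB.
    have -> : w a' = g a' + t * (f a' - g a') by [].
    lra.
  move=> Svw; rewrite -(ler_pM2l t0).
  by have := Smin _ (ex_intro _ _ Svw); rewrite /M; lra.
have young := dual_young j (- q).
rewrite dual_argN normrN nq nj in young.
have m0 : 0 <= M + (2^-1 * `|p| ^+ 2 + 2^-1 * `|g| ^+ 2).
  have := dual_young g (- p); rewrite dual_argN normrN; lra.
(* By [key] and Young's inequality for [j] at [- q], the monotonicity pairing is at least [m], which
   [m0] shows nonnegative. *)
have Aqj : A (- q) (- j).
  apply: A_max => a f Aaf; have := key _ _ Aaf.
  rewrite !(dualBE, dual_argB, dualNE, dual_argN) jp gq; lra.
exists (- q), (- j); split => //.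
(* The condition at the graph point just found bounds [j q] from above. *)
have := key _ _ Aqj.
rewrite !(dualBE, dual_argB, dualNE, dual_argN) !normrN jp gq nq nj; lra.
Qed.

End rockafellar.

(** * Closedness of the graph, outer limits and boundary points *)

(** Monotonicity passes to the limit: replacing [(y, f)] by [(x, xs)] changes the pairing with a
    graph point by at most [e' * C]. *)
Lemma maximal_monotone_closed (R : realType) (X : normedModType R)
    (A : X -> set (dual X)) (x : X) (xs : dual X) :
  maximal_monotone A ->
  (forall e, 0 < e -> exists y f, [/\ A y f, `|x - y| < e & `|xs - f| < e]) ->
  A x xs.
Proof.
move=> A_max near_xs; apply: maximal_monotone_in => // a g Aag.
pose C := `|xs - g| + 1 + `|x - a|.
have C0 : 0 < C by rewrite ltr_wpDr// ltr_wpDl.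
apply/ler_addgt0Pr => e e0; pose e' := Num.min 1 (e / C).
have e'0 : 0 < e' by rewrite lt_min ltr01 divr_gt0.
have e'1 : e' <= 1 by rewrite ge_min lexx.
have e'C : e' * C <= e by rewrite -ler_pdivlMr// ge_min lexx orbT.
have [y [f [Ayf xy fx]]] := near_xs _ e'0.
have mon := A_max.1 _ _ _ _ Ayf Aag.
have fg : `|f - g| <= `|xs - g| + 1.
  have -> : f - g = (xs - g) - (xs - f) by rewrite opprB [RHS]addrC addrA subrK.
  by rewrite (le_trans (ler_normB _ _))// lerD2l (le_trans (ltW fx)).
have h1 := le_trans (ler_norm _) (dual_pair_le (f - g) (y - x)).
have h2 := le_trans (ler_norm _) (dual_pair_le (f - xs) (x - a)).
have h3 : `|f - g| * `|y - x| <= (`|xs - g| + 1) * e'.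
  by rewrite ler_pM// distrC ltW.
have h4 : `|f - xs| * `|x - a| <= e' * `|x - a|.
  by rewrite ler_wpM2r// distrC ltW.
move: mon h1 h2; rewrite !(dualBE, dual_argB); rewrite /C in e'C.
move: e'C h3 h4; lra.
Qed.

Lemma LimsupP (R : realType) (X : normedModType R)
    (A : X -> set (dual X)) (x : X) (xs : dual X) :
  Limsup A x xs <-> forall e, 0 < e ->
    exists y f, [/\ A y f, y != x, `|x - y| < e & `|xs - f| < e].
Proof.
split=> [[y [f [yx fxs ynx Ayf]]] e e0|near_xs].
  move/cvgrPdist_lt: yx => /(_ _ e0)[N _ NP].
  move/cvgrPdist_lt: fxs => /(_ _ e0)[N' _ N'P].
  exists (y (maxn N N')), (f (maxn N N')); split => //.
    by apply: NP; rewrite /= leq_maxl.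
  by apply: N'P; rewrite /= leq_maxr.
have /choice[yf yfP] : forall n : nat, exists yf : X * dual X,
    [/\ A yf.1 yf.2, yf.1 != x, `|x - yf.1| < n.+1%:R^-1 &
        `|xs - yf.2| < n.+1%:R^-1].
  move=> n; have [|y [f yfP]] := near_xs n.+1%:R^-1.
    by rewrite invr_gt0 ltr0n.
  by exists (y, f).
exists (fun n => (yf n).1), (fun n => (yf n).2); split.
- apply/cvgrPdist_lt => e e0.
  have [N _ NP] := near_infty_natSinv_lt (PosNum e0).
  by exists N => // n /NP; apply: lt_trans; have [] := yfP n.
- apply/cvgrPdist_lt => e e0.
  have [N _ NP] := near_infty_natSinv_lt (PosNum e0).
  by exists N => // n /NP; apply: lt_trans; have [] := yfP n.
- by move=> n; have [] := yfP n.
- by move=> n; have [] := yfP n.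
Qed.

Lemma monotone_not_interior (R : realType) (X : normedModType R)
    (A : X -> set (dual X)) (x : X) (xs : dual X) :
  monotone_operator A -> Limsup A x xs -> ~ interior (A x) xs.
Proof.
move=> A_mon /LimsupP lim /nbhs_ballP[r /= r0 rA].
have [|y [f [Ayf yx _ fxs]]] := lim (r / 4); first by rewrite divr_gt0.
have v0 : 0 < `|y - x| by rewrite normr_gt0 subr_eq0.
have [j [jv nj]] := norming_functional (y - x).
(* The scaling gives [u] norm [r / 2], attained in the direction [y - x]; monotonicity then forces
   [f] to be at least [r / 2] away from [xs]. *)
pose u := (r / 2 / `|y - x|) *: j.
have Axu : A x (xs + u).
  apply: rA; rewrite -ball_normE /= opprD addrA subrr add0r normrN normrZ nj.
  rewrite ger0_norm ?divr_ge0 ?ltW// divfK ?gt_eqF//.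
  by rewrite ltr_pdivrMr// ltr_pMr// ltr1n.
have := A_mon _ _ _ _ Ayf Axu.
have uv : u (y - x) = r / 2 * `|y - x|.
  by rewrite dualZE jv expr2 mulrA divfK// gt_eqF.
rewrite opprD addrA dualBE uv subr_ge0 => h.
have := le_trans h (le_trans (ler_norm _) (dual_pair_le _ _)).
rewrite ler_pM2r// distrC => h'; lra.
Qed.

Lemma maximal_monotone_near (R : realType) (X : completeNormedModType R)
    (A : X -> set (dual X)) (x : X) (xs zs : dual X) :
  uniformly_convex X -> uniformly_convex (dual X) -> maximal_monotone A ->
  A x xs -> ~ A x zs ->
  exists y f, [/\ A y f, y != x, `|x - y| <= 2 * `|xs - zs| &
    `|xs - f| <= 3 * `|xs - zs|].
Proof.
move=> X_uc dX_uc A_max Axxs nAxzs.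
pose B y := [set f | A (x + y) (zs + f)].
have [|||y [f [Byf yf]]] := @rockafellar R X B (@complete_seq_complete _ X) X_uc dX_uc.
- move=> a b f g Bf Bg.
  have := A_max.1 _ _ _ _ Bf Bg; rewrite !opprD.
  by rewrite addrACA subrr add0r addrACA subrr add0r.
- move=> p g pg; apply: (@maximal_monotone_in _ _ A _ _ A_max) => a f Aaf.
  have Baf : B (a - x) (f - zs).
    by rewrite /B /= [x + _]addrC [zs + _]addrC !subrK.
  by have := pg _ _ Baf; rewrite !(dualBE, dualDE, dual_argB, dual_argD); lra.
- by exists 0, (xs - zs); rewrite /B /= addr0 addrC subrK.
set dl := `|xs - zs|.
have mon : - f y <= dl * `|y|.
  have := A_max.1 _ _ _ _ Axxs Byf.
  have := le_trans (ler_norm _) (dual_pair_le (xs - zs) (- y)).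
  by rewrite normrN -/dl !(dualBE, dualDE, dual_argB, dual_argD, dual_argN); lra.
have dl0 : 0 <= dl by exact: normr_ge0.
have yf' : `|y| ^+ 2 + `|f| ^+ 2 <= 2 * dl * `|y| by lra.
have f2 := sqr_ge0 `|f|.
(* If [y] vanished, so would [f] by [yf'], and [zs] would lie in [A x]. *)
have y0 : y != 0.
  apply/eqP => y0; apply: nAxzs; move: Byf; rewrite /B /= y0 addr0.
  suff -> : f = 0 by rewrite addr0.
  apply/eqP; rewrite -normr_eq0 -sqrf_eq0; apply/eqP/le_anti; rewrite f2 andbT.
  by move: yf'; rewrite y0 normr0 expr0n /= mulr0 add0r.
have ny0 : 0 < `|y| by rewrite normr_gt0.
have ydl : `|y| <= 2 * dl by rewrite -(ler_pM2r ny0); nra.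
have fdl : `|f| <= 2 * dl.
  by rewrite -ler_sqr ?nnegrE ?mulr_ge0//; nra.
exists (x + y), (zs + f); split => //.
- by rewrite -subr_eq0 addrC addKr.
- by rewrite opprD addrA subrr add0r normrN.
- rewrite opprD addrA (le_trans (ler_normB _ _))// -/dl; lra.
Qed.

Theorem corollary3p1 (R : realType) (X : completeNormedModType R)
  (A : X -> set (dual X))
  (X_uc : uniformly_convex X) (dualX_uc : uniformly_convex (dual X))
  (A_max : maximal_monotone A) (x : X) (x_dom : domain A x) :
  boundary (A x) = Limsup A x.
Proof.
apply/seteqP; split=> [xs [cl_xs not_int]|xs lim].
  have Axxs : A x xs.
    apply: maximal_monotone_closed => // e e0.
    have [f [Axf]] := cl_xs _ (nbhsx_ballx xs e e0).
    by rewrite -ball_normE /= => xsf; exists x, f; rewrite subrr normr0.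
  apply/LimsupP => e e0.
  (* A quarter suffices because [maximal_monotone_near] loses factors 2 and 3. *)
  have e4 : 0 < e / 4 by rewrite divr_gt0.
  have [zs [xszs nAzs]] : exists zs, `|xs - zs| < e / 4 /\ ~ A x zs.
    apply: contrapT => none; apply: not_int; apply/nbhs_ballP.
    exists (e / 4) => // zs; rewrite -ball_normE /= => xszs.
    by apply: contrapT => nAzs; apply: none; exists zs.
  have [y [f [Ayf yx xy xsf]]] :=
    maximal_monotone_near X_uc dualX_uc A_max Axxs nAzs.
  by exists y, f; split => //; lra.
split; last exact: monotone_not_interior A_max.1 lim.
apply: subset_closure; apply: maximal_monotone_closed => // e e0.
by have /LimsupP/(_ _ e0)[y [f [Ayf _ xy xsf]]] := lim; exists y, f.
Qed.
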